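(* Let $\mathcal B^0_\epsilon:=\mathbb Z_\epsilon[a]/\langle(1+\epsilon)a,\ (a-(1-\epsilon))^2(a+(1-\epsilon))\rangle$ and let $F_t$ be the $(2,2)$-series $$F_t(x,y)=1+(1-\epsilon)(x+y)t+\big(-\epsilon(x^2+y^2)+a\,xy\big)t^2$$ over $\mathcal B^0_\epsilon$. Then the $(4,3)$-series $C_t(F)(x,y,z):=F_t(F_t(x,y),z)=1+\sum_{i=1}^4C_i(F)(x,y,z)\,t^i$ is given by $$C_1(F)=2(1-\epsilon)\sigma(x),$$ $$C_2(F)=2(1-2\epsilon)\sigma(x^2)+(a+4)(1-\epsilon)\sigma(xy),$$ $$C_3(F)=2(1-\epsilon)\sigma(x^3)+2(1-\epsilon)(1+a)\sigma(x^2y)+2(1-\epsilon)(a^2-a+4)\sigma(xyz),$$ $$C_4(F)=\sigma(x^4)+2a\,\sigma(x^3y)+(2+a^2)\sigma(x^2y^2)+2(a^2+a)\sigma(x^2yz).$$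
   Context: $\mathbb Z_\epsilon:=\mathbb Z[\epsilon]/(\epsilon^2-1)$. $\sigma(m)$ denotes the sum of all distinct monomials obtained from the monomial $m$ by permuting $x,y,z$ (so $\sigma(xyz)=xyz$). An $(n,d)$-series over a commutative ring $R$ is a polynomial $F_t(\underline x)=1+F_1(\underline x)t+\dots+F_n(\underline x)t^n$ with $F_l\in R[[x_1,\dots,x_d]]$. For a $(2,2)$-series $F_t=1+F_1t+F_2t^2$ with $F_1(0,0)=F_2(0,0)=0$, the series $F_t(F_t(x,y),z)$ is defined by substitution as follows. The product $F_t(u_1,z)F_t(u_2,z)$ is symmetric in the auxiliary variables $u_1,u_2$, hence is uniquely of the form $\Phi(u_1+u_2,u_1u_2,z)$, with $\Phi$ a polynomial in $t$ whose coefficients are power series; then $F_t(F_t(x,y),z):=\Phi(F_1(x,y),F_2(x,y),z)$. The series $F_t$ of the statement is the $\mathbb Z_\epsilon$-refinement of the degree-zero universal $2$-valued formal group law. *)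

(* Defs.v *)
From HB Require Import structures.
From mathcomp Require Import all_boot all_algebra all_fingroup.
From mathcomp Require Import boolp classical_sets.
From mathcomp.multinomials Require Import mpoly.
Set Implicit Arguments.
Unset Strict Implicit.
Unset Printing Implicit Defensive.
Import GRing.Theory.
Local Open Scope ring_scope.

(* The power series ring R[[x_0, ..., x_(d-1)]]: arbitrary coefficient
   families indexed by monomials, with the convolution product. *)
Record mpseries (d : nat) (R : Type) := MPSeries {
  mpcoef :> 'X_{1..d} -> R
}.

HB.instance Definition _ d R := gen_eqMixin (mpseries d R).
HB.instance Definition _ d R := gen_choiceMixin (mpseries d R).

Section PowerSeriesRing.
Variables (d : nat) (R : comNzRingType).
Implicit Types (f g h : mpseries d R) (m : 'X_{1..d}).

Lemma mpseriesP f g : (forall m, f m = g m) -> f = g.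
Proof. by case: f g => [f] [g] /= /funext ->. Qed.

Definition mpseriesC (c : R) : mpseries d R :=
  MPSeries (fun m => if m == 0%MM then c else 0).

Definition mpseriesM f g : mpseries d R :=
  MPSeries (fun m =>
    \sum_(k : 'X_{1..d < (mdeg m).+1, (mdeg m).+1} | m == (k.1 + k.2)%MM)
      f k.1 * g k.2).

Definition mpseriesD f g : mpseries d R := MPSeries (fun m => f m + g m).
Definition mpseriesN f : mpseries d R := MPSeries (fun m => - f m).

Fact mpseriesDA : associative mpseriesD.
Proof. by move=> f g h; apply: mpseriesP => m /=; rewrite addrA. Qed.
Fact mpseriesDC : commutative mpseriesD.
Proof. by move=> f g; apply: mpseriesP => m /=; rewrite addrC. Qed.
Fact mpseries0D : left_id (mpseriesC 0) mpseriesD.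
Proof. by move=> f; apply: mpseriesP => m /=; rewrite if_same add0r. Qed.
Fact mpseriesND : left_inverse (mpseriesC 0) mpseriesN mpseriesD.
Proof. by move=> f; apply: mpseriesP => m /=; rewrite if_same addNr. Qed.

HB.instance Definition _ := GRing.isZmodule.Build (mpseries d R)
  mpseriesDA mpseriesDC mpseries0D mpseriesND.

(* The ring axioms for the product are inherited from polynomials, a
   coefficient of a product depending only on finitely many coefficients. *)
Let trunc N f : {mpoly R[d]} := \sum_(m : 'X_{1..d < N}) f m *: 'X_[m].

Let truncE N f m : (mdeg m < N)%N -> (trunc N f)@_m = f m.
Proof. exact: mcoeff_mpoly. Qed.

Let eq_mcoeffM (p p' q q' : {mpoly R[d]}) N m : (mdeg m < N)%N ->
  (forall k, (mdeg k < N)%N -> p@_k = p'@_k) ->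
  (forall k, (mdeg k < N)%N -> q@_k = q'@_k) ->
  (p * q)@_m = (p' * q')@_m.
Proof.
move=> mN pp qq; rewrite !mcoeffM; apply: eq_bigr => -[k1 k2] /= _.
by rewrite pp ?qq ?(leq_trans (bmdeg _)).
Qed.

Let mpseriesME N f g m : (mdeg m < N)%N ->
  mpseriesM f g m = (trunc N f * trunc N g)@_m.
Proof.
move=> mN; rewrite mcoeffM /=; apply: eq_bigr => -[k1 k2] /= _.
by rewrite !truncE ?(leq_trans (bmdeg _)).
Qed.

Let mpseriesM_trunc N f g m : (mdeg m < N)%N ->
  (trunc N (mpseriesM f g))@_m = (trunc N f * trunc N g)@_m.
Proof. by move=> mN; rewrite truncE // (mpseriesME _ _ mN). Qed.

Fact mpseriesMA : associative mpseriesM.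
Proof.
move=> f g h; apply: mpseriesP => m; set N := (mdeg m).+1.
rewrite !(@mpseriesME N) //.
rewrite (@eq_mcoeffM _ (trunc N f) _ (trunc N g * trunc N h) N) //.
  by rewrite mulrA; apply: (@eq_mcoeffM _ _ _ _ N) => // k kN; rewrite mpseriesM_trunc.
by move=> k kN; rewrite mpseriesM_trunc.
Qed.

Fact mpseriesMC : commutative mpseriesM.
Proof.
move=> f g; apply: mpseriesP => m.
by rewrite !(@mpseriesME (mdeg m).+1) // mulrC.
Qed.

Fact mpseries1M : left_id (mpseriesC 1) mpseriesM.
Proof.
move=> f; apply: mpseriesP => m; set N := (mdeg m).+1.
rewrite (@mpseriesME N) // (@eq_mcoeffM _ 1 _ (trunc N f) N) //.
  by rewrite mul1r truncE.
by move=> k kN; rewrite truncE // mcoeff1 /=; case: eqP.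
Qed.

Fact mpseriesMDl : left_distributive mpseriesM +%R.
Proof.
move=> f g h; apply: mpseriesP => m /=; rewrite -big_split /=.
by apply: eq_bigr => k _; rewrite mulrDl.
Qed.

Fact mpseries1_neq0 : mpseriesC 1 != 0.
Proof.
apply/eqP => /(congr1 (fun f : mpseries d R => f 0%MM)) /=.
by rewrite eqxx => /eqP; rewrite oner_eq0.
Qed.

HB.instance Definition _ := GRing.Zmodule_isComNzRing.Build (mpseries d R)
  mpseriesMA mpseriesMC mpseries1M mpseriesMDl mpseries1_neq0.

Definition mpmonomial m : mpseries d R := MPSeries (fun m' => (m' == m)%:R).

Definition mpvar (i : 'I_d) : mpseries d R := mpmonomial U_(i)%MM.

(* Sum of the distinct monomials in the orbit of m under permutation of the
   variables. *)
Definition sigma m : mpseries d R :=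
  \sum_(m' <- undup [seq [multinom m (s i) | i < d] | s : 'S_d]) mpmonomial m'.

End PowerSeriesRing.

Arguments mpseriesC {d R} c.
Arguments mpmonomial {d R} m.
Arguments mpvar {d R} i.
Arguments sigma {d R} m.

Notation "c %:S" := (mpseriesC c) (at level 2, left associativity, format "c %:S")
  : ring_scope.

(* Substitution f(g_0, ..., g_(k-1)) for series g_i without constant term: the
   product of the g_i ^+ (j i) then has order at least mdeg j, so that only the
   j with mdeg j <= mdeg m contribute to the coefficient of m. *)
Definition mpsubst (k d : nat) (R : comNzRingType)
    (g : k.-tuple (mpseries d R)) (f : mpseries k R) : mpseries d R :=
  MPSeries (fun m =>
    \sum_(j : 'X_{1..k < (mdeg m).+1}) f j * (\prod_(i < k) tnth g i ^+ j i) m).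

Lemma mpsubst0 k d (R : comNzRingType) (g : k.-tuple (mpseries d R)) :
  mpsubst g 0 = 0.
Proof.
by apply: mpseriesP => m /=; rewrite if_same big1 // => j _; rewrite if_same mul0r.
Qed.

(* Coefficientwise in t; map_poly is faithful to this by mpsubst0. *)
Definition tsubst (k d : nat) (R : comNzRingType)
    (g : k.-tuple (mpseries d R)) (F : {poly mpseries k R}) :
    {poly mpseries d R} :=
  map_poly (mpsubst g) F.

Definition is_nd_series (n d : nat) (R : comNzRingType)
    (F : {poly mpseries d R}) : Prop :=
  (size F <= n.+1)%N /\ F`_0 = 1.
Arguments is_nd_series n {d R} F.

Section Iterate.
Variable R : comNzRingType.
Implicit Types F : {poly mpseries 2 R}.

(* Phi(u1 + u2, u1 u2, z) = F_t(u1, z) F_t(u2, z), in R[[u1, u2, z]][t] *)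
Definition symmetrizes F (Phi : {poly mpseries 3 R}) : Prop :=
  let u1 : mpseries 3 R := mpvar 0 in
  let u2 : mpseries 3 R := mpvar 1 in
  let z : mpseries 3 R := mpvar 2 in
  tsubst [tuple u1 + u2; u1 * u2; z] Phi
  = tsubst [tuple u1; z] F * tsubst [tuple u2; z] F.

(* Phi exists and is unique, the right-hand side above being symmetric in
   u1, u2; the default value 0 is never used. *)
Definition sym_form F : {poly mpseries 3 R} :=
  xget 0 [set Phi | symmetrizes F Phi]%classic.

(* F_t(F_t(x, y), z); meaningful for a (2,2)-series F = 1 + F_1 t + F_2 t^2
   with F_1(0, 0) = F_2(0, 0) = 0. *)
Definition iterate F : {poly mpseries 3 R} :=
  let x : mpseries 3 R := mpvar 0 in
  let y : mpseries 3 R := mpvar 1 in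
  let z : mpseries 3 R := mpvar 2 in
  tsubst [tuple mpsubst [tuple x; y] F`_1; mpsubst [tuple x; y] F`_2; z]
    (sym_form F).

End Iterate.

(* The library quotients {poly R} by mk_monic p, which is p itself when p is
   monic of positive degree. *)
Definition Zeps : comNzRingType := {poly %/ ('X^2 - 1 : {poly int})}.
Definition zeps : Zeps := 'qX.

Lemma mk_monic_X2sub1 : mk_monic ('X^2 - 1 : {poly int}) = 'X^2 - 1.
Proof. by rewrite /mk_monic size_XnsubC // monicXnsubC. Qed.

(* epsilon |-> 1; only needed to see that the ideal defining B0 is proper. *)
Definition aug (p : Zeps) : int := (p : {poly int}).[1].

Lemma augE (p : {poly int}) : aug (in_qpoly ('X^2 - 1) p) = p.[1].
Proof.
rewrite /aug /= mk_monic_X2sub1 [p in RHS](Pdiv.RingMonic.rdivp_eq (monicXnsubC 1 (isT : 0 < 2)%N)).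
by rewrite hornerD hornerM [(_ - _).[_]]hornerE hornerN hornerXn hornerC expr1n subrr mulr0 add0r.
Qed.

Lemma augM p q : aug (p * q) = aug p * aug q.
Proof. by rewrite [LHS]augE hornerM. Qed.

Lemma augD p q : aug (p + q) = aug p + aug q.
Proof. by rewrite /aug /= hornerD. Qed.

Lemma aug1 : aug 1 = 1.
Proof. by rewrite -(in_qpoly1 ('X^2 - 1)) augE hornerC. Qed.

Lemma aug_1subeps : aug (1 - zeps) = 0.
Proof.
by rewrite /zeps /qpolyX -(in_qpoly1 ('X^2 - 1)) -raddfB augE !hornerE subrr.
Qed.

Lemma zeps_sqr : zeps ^+ 2 = 1.
Proof.
apply/eqP; rewrite -subr_eq0 -(in_qpoly1 ('X^2 - 1)) /zeps /qpolyX -rmorphXn.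
rewrite -rmorphB; apply/eqP/val_inj; rewrite /= mk_monic_X2sub1.
by rewrite Pdiv.RingMonic.rmodpp // monicXnsubC.
Qed.

(* The ideal generated by g and h. *)
Definition ideal2 (R : comNzRingType) (g h : R) : {pred R} :=
  fun p => `[< exists u v, p = u * g + v * h >].

Definition B0rel1 : {poly Zeps} := (1 + zeps)%:P * 'X.
Definition B0rel2 : {poly Zeps} :=
  ('X - (1 - zeps)%:P) ^+ 2 * ('X + (1 - zeps)%:P).

Definition B0ideal : {pred {poly Zeps}} := ideal2 B0rel1 B0rel2.

Fact B0ideal_closed : idealr_closed B0ideal.
Proof.
split.
- by apply/asboolP; exists 0, 0; rewrite !mul0r addr0.
- apply/asboolP => -[u [v /(congr1 (fun p : {poly Zeps} => aug p`_0))]].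
  rewrite coef1 aug1 coefD /B0rel1 /B0rel2 !coef0M.
  by rewrite !(coefD, coefN, coefX, coefC) /= !(mulr0, add0r) !augM aug_1subeps !mulr0.
- move=> c p q /asboolP [u [v ->]] /asboolP [u' [v' ->]]; apply/asboolP.
  exists (c * u + u'), (c * v + v').
  by rewrite !mulrDl mulrDr !mulrA addrACA.
Qed.

HB.instance Definition _ := isIdealr.Build {poly Zeps} B0ideal B0ideal_closed.

Definition B0 : comNzRingType := {ideal_quot B0ideal}.

Definition B0pi : {rmorphism {poly Zeps} -> B0} := \pi_{ideal_quot B0ideal}%qT.
Definition B0eps : B0 := B0pi zeps%:P.
Definition B0a : B0 := B0pi 'X.

Lemma B0pi_eq0 p : (B0pi p == 0) = (p \in B0ideal).
Proof. by rewrite -[p in RHS]subr0 Quotient.idealrBE [(\pi 0)%qT](rmorph0 B0pi). Qed.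

Lemma B0rels : [/\ B0eps ^+ 2 = 1, (1 + B0eps) * B0a = 0
  & (B0a - (1 - B0eps)) ^+ 2 * (B0a + (1 - B0eps)) = 0].
Proof.
have r1 : B0pi B0rel1 = 0.
  apply/eqP; rewrite B0pi_eq0; apply/asboolP.
  by exists 1, 0; rewrite mul1r mul0r addr0.
have r2 : B0pi B0rel2 = 0.
  apply/eqP; rewrite B0pi_eq0; apply/asboolP.
  by exists 0, 1; rewrite mul1r mul0r add0r.
split.
- by rewrite -rmorphXn -polyC_exp zeps_sqr rmorph1.
- by rewrite -r1 rmorphM polyCD rmorphD rmorph1.
- have e : B0pi (1 - zeps)%:P = 1 - B0eps by rewrite polyCB rmorphB rmorph1.
  rewrite /B0a -e -(rmorphB B0pi) -(rmorphD B0pi) -rmorphXn -rmorphM.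
  exact: r2.
Qed.

Section UniversalSeries.
Variables (R : comNzRingType) (eps a : R).
Let x : mpseries 2 R := mpvar 0.
Let y : mpseries 2 R := mpvar 1.

Definition Funiv : {poly mpseries 2 R} :=
  1 + ((1 - eps)%:S * (x + y)) *: 'X
    + ((- eps)%:S * (x ^+ 2 + y ^+ 2) + a%:S * (x * y)) *: 'X^2.

Lemma Funiv_coefs :
  [/\ Funiv`_0 = 1, Funiv`_1 = (1 - eps)%:S * (x + y)
    & Funiv`_2 = (- eps)%:S * (x ^+ 2 + y ^+ 2) + a%:S * (x * y)].
Proof.
by split; rewrite /Funiv !(coefD, coefZ, coefX, coefXn, coef1) /=
  ?(mulr0, mulr1, addr0, add0r).
Qed.

Lemma Funiv_const : Funiv`_1 0%MM = 0 /\ Funiv`_2 0%MM = 0.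
Proof.
case: Funiv_coefs => _ -> ->.
have c0M (f g : mpseries 2 R) : (f * g) 0%MM = f 0%MM * g 0%MM.
  rewrite [LHS]/= (eq_bigl (pred1 (bm0, bm0))); first exact: big_pred1_eq.
  case=> k1 k2 /=; rewrite eq_sym -mdeg_eq0 mdegD addn_eq0 !mdeg_eq0.
  by rewrite xpair_eqE !bmeqP.
have c0D (f g : mpseries 2 R) : (f + g) 0%MM = f 0%MM + g 0%MM by [].
have c0var i : (mpvar i : mpseries 2 R) 0%MM = 0.
  by rewrite /= eq_sym mnm1_eq0.
by rewrite !expr2 !(c0M, c0D) !c0var !(mulr0, addr0).
Qed.

Lemma Funiv_series : is_nd_series 2 Funiv.
Proof.
split; last by case: Funiv_coefs.
apply/leq_sizeP => i i_gt2.
by rewrite /Funiv !(coefD, coefZ, coefX, coefXn, coef1) !gtn_eqF ?mulr0 ?addr0 //;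
  apply: leq_trans i_gt2.
Qed.

End UniversalSeries.

Definition mon3 (i j k : nat) : 'X_{1..3} := [multinom [tuple i; j; k]].

(* Main.v *)
(* Expanding F_t(u1, z) F_t(u2, z) and rewriting it in s = u1 + u2, p = u1 u2
   gives an explicit Phi; it is the only one, since (s, p, z) are algebraically
   independent even for power series.  Substituting s = F_1(x, y) and
   p = F_2(x, y) gives the coefficients C_i, which are brought to the stated form
   by the rules eps^2 = 1, eps a = - a and a^3 = 2 a^2 + 4 a - 4 + 4 eps; the last
   is the cubic relation expanded with the help of the other two. *)
From HB Require Import structures.
Require Import Defs.
From mathcomp Require Import all_boot all_algebra all_fingroup classical_sets.
From mathcomp Require Import ring.
From mathcomp.multinomials Require Import mpoly.
Set Implicit Arguments.
Unset Strict Implicit.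
Unset Printing Implicit Defensive.
Import GRing.Theory.
Local Open Scope ring_scope.

(** * Coefficients and orders of power series *)

Section Series.
Variables (d : nat) (R : comNzRingType).
Implicit Types (f g h : mpseries d R) (m : 'X_{1..d}).

Lemma mpcoefD f g m : (f + g) m = f m + g m.
Proof. by []. Qed.

Lemma mpcoef_sum m (I : Type) (r : seq I) (P : pred I) (F : I -> mpseries d R) :
  (\sum_(i <- r | P i) F i) m = \sum_(i <- r | P i) F i m.
Proof. by elim/big_rec2: _ => [|i a b _ <-] //=; rewrite if_same. Qed.

Lemma mpcoefM f g m : (f * g) m =
  \sum_(k : 'X_{1..d < (mdeg m).+1, (mdeg m).+1} | m == (k.1 + k.2)%MM)
    f k.1 * g k.2.
Proof. by []. Qed.

Lemma mpcoefMX f k m :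
  (f * mpmonomial k) m = if (k <= m)%MM then f (m - k)%MM else 0.
Proof.
rewrite mpcoefM; case: ifP => [km|/negP nkm]; last first.
  rewrite big1 // => -[k1 k2] /= /eqP mE; case: eqP => [k2E|]; last by rewrite mulr0.
  by case: nkm; rewrite mE k2E lem_addl.
have m1 : (mdeg (m - k) < (mdeg m).+1)%N by rewrite ltnS mdegB.
have m2 : (mdeg k < (mdeg m).+1)%N by rewrite -(submK km) mdegD ltnS leq_addl.
rewrite (bigD1 (BMultinom m1, BMultinom m2)) /= ?submK // eqxx mulr1.
rewrite big1 ?addr0 // => -[k1 k2] /= /andP[/eqP mE ne].
case: eqP => [k2E|]; last by rewrite mulr0.
case/eqP: ne; congr pair; apply: val_inj => //=.
by have := congr1 (fun l => l - k)%MM mE; rewrite -k2E addmK => ->.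
Qed.

Lemma mpcoefCM c f m : (c%:S * f) m = c * f m.
Proof.
rewrite mpcoefM.
rewrite (bigD1 (bm0, BMultinom (ltnSn (mdeg m)))) /= ?add0m ?eqxx //.
rewrite big1 ?addr0 //.
case=> k1 k2 /= /andP[/eqP mE ne]; case: eqP => [k1E|]; last by rewrite mul0r.
case/eqP: ne; congr pair; apply: val_inj => //=.
by rewrite -[LHS]add0m -k1E -mE.
Qed.

Fact mpseriesC_is_additive : zmod_morphism (@mpseriesC d R).
Proof.
move=> a b; apply: mpseriesP => m /=.
by case: ifP; rewrite ?subr0.
Qed.

Fact mpseriesC_is_multiplicative : monoid_morphism (@mpseriesC d R).
Proof.
split=> // a b; apply: mpseriesP => m; rewrite mpcoefCM /=.
by case: ifP; rewrite ?mulr0.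
Qed.

HB.instance Definition _ :=
  GRing.isZmodMorphism.Build R (mpseries d R) mpseriesC mpseriesC_is_additive.
HB.instance Definition _ :=
  GRing.isMonoidMorphism.Build R (mpseries d R) mpseriesC
    mpseriesC_is_multiplicative.

Lemma mpmonomialD k l :
  mpmonomial (k + l)%MM = mpmonomial k * mpmonomial l :> mpseries d R.
Proof.
apply: mpseriesP => m; rewrite mpcoefMX /=.
case: ifP => [lm|/negP nlm].
  suff -> : (m == k + l)%MM = (m - l == k)%MM by [].
  by apply/eqP/eqP => [->|<-]; rewrite ?addmK ?submK.
case: eqP => // mE; case: nlm; rewrite mE; exact: lem_addl.
Qed.

(** Membership in the [n]-th power of the ideal generated by the variables. *)
Definition order_ge f n := forall m, (mdeg m < n)%N -> f m = 0.

Lemma order_geM f g a b :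
  order_ge f a -> order_ge g b -> order_ge (f * g) (a + b).
Proof.
move=> fa gb m mab; rewrite mpcoefM big1 // => -[k1 k2] /= /eqP mE.
have [k1a|ak1] := ltnP (mdeg k1) a; first by rewrite fa ?mul0r.
rewrite gb ?mulr0 // -(ltn_add2l (mdeg k1)) -mdegD -mE.
by apply: leq_trans mab _; rewrite leq_add2r.
Qed.

Lemma order_geX f a n : order_ge f a -> order_ge (f ^+ n) (a * n).
Proof.
by move=> fa; elim: n => [|n IH]; rewrite ?muln0 // exprS mulnS; apply: order_geM.
Qed.

End Series.

(** * Substitution of series without constant term is a ring morphism *)

Section Substitution.
Variables (k d : nat) (R : comNzRingType) (g : k.-tuple (mpseries d R)).
Hypothesis g0 : forall i, tnth g i 0%MM = 0.

Local Notation subst := (mpsubst g).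

(** Each factor [tnth g i] has order at least 1 by [g0], and orders add up in products. This makes
    the truncated sum in [mpsubst] the full one. *)
Lemma order_ge_mmap1 j : order_ge (mmap1 (tnth g) j) (mdeg j).
Proof.
rewrite mdegE /mmap1; elim/big_rec2: _ => // i n f _ nf.
apply: order_geM => //; rewrite -[X in order_ge _ X]mul1n; apply: order_geX => m.
by rewrite ltnS leqn0 mdeg_eq0 => /eqP ->.
Qed.

Lemma mpcoef_mmap (p : {mpoly R[k]}) N m : (mdeg m < N)%N ->
  mmap mpseriesC (tnth g) p m =
  \sum_(j : 'X_{1..k < N}) p@_j * mmap1 (tnth g) j m.
Proof.
(* The case of a single term [c *: 'X_[q]]; when [q] has degree at least [N], both sides vanish by
   the order bound. *)
move=> mN; have trunc (q : 'X_{1..k}) (c : R) :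
    c * mmap1 (tnth g) q m =
    \sum_(j : 'X_{1..k < N}) (c *: 'X_[q] : {mpoly R[k]})@_j * mmap1 (tnth g) j m.
  have [qN|Nq] := ltnP (mdeg q) N; last first.
    rewrite order_ge_mmap1 ?mulr0; last exact: leq_trans mN Nq.
    rewrite big1 // => j _; rewrite mcoeffZ mcoeffX; case: eqP => [qE|].
      by have := bmdeg j; rewrite -qE ltnNge Nq.
    by rewrite mulr0 mul0r.
  rewrite (bigD1 (BMultinom qN)) //= mcoeffZ mcoeffX eqxx mulr1.
  rewrite big1 ?addr0 // => j /eqP ne; rewrite mcoeffZ mcoeffX.
  case: eqP => [qE|]; last by rewrite mulr0 mul0r.
  by case: ne; apply: val_inj.
rewrite /mmap mpcoef_sum.
under eq_bigr => q _ do rewrite mpcoefCM trunc.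
rewrite exchange_big /=; apply: eq_bigr => j _; rewrite -mulr_suml.
by rewrite [p in RHS]mpolyE raddf_sum.
Qed.

Let trunc N (f : mpseries k R) : {mpoly R[k]} :=
  \sum_(j : 'X_{1..k < N}) f j *: 'X_[j].

(** The bound [N] is free so that one truncation serves all the coefficients entering a coefficient
    of a product. *)
Lemma mpsubst_mmap f N m : (mdeg m < N)%N ->
  subst f m = mmap mpseriesC (tnth g) (trunc N f) m.
Proof.
move=> mN; rewrite (@mpcoef_mmap _ (mdeg m).+1) //=; apply: eq_bigr => j _.
by rewrite mcoeff_mpoly // (leq_trans (bmdeg j)).
Qed.

Lemma mpsubstE f m :
  subst f m = \sum_(j : 'X_{1..k < (mdeg m).+1}) f j * mmap1 (tnth g) j m.
Proof. by []. Qed.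

Lemma mpsubstD : {morph subst : f h / f + h}.
Proof.
move=> f h; apply: mpseriesP => m /=; rewrite -big_split /=.
by apply: eq_bigr => j _; rewrite mulrDl.
Qed.

(* A coefficient of a substitution is that of the evaluation of a polynomial
   truncation, and evaluation of polynomials is multiplicative. *)
Lemma mpsubstM : {morph subst : f h / f * h}.
Proof.
move=> f h; apply: mpseriesP => m; set N := (mdeg m).+1.
transitivity (mmap mpseriesC (tnth g) (trunc N f * trunc N h) m).
  rewrite (@mpcoef_mmap _ N) //=; apply: eq_bigr => j _; congr (_ * _).
  rewrite mcoeffM; apply: eq_bigr => -[k1 k2] /= _.
  by rewrite !mcoeff_mpoly // (leq_trans (bmdeg _)) // bmdeg.
rewrite rmorphM [LHS]mpcoefM [RHS]mpcoefM; apply: eq_bigr => -[k1 k2] /= _.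
by rewrite -!mpsubst_mmap // (leq_trans (bmdeg _)).
Qed.

Lemma mpsubstC c : subst c%:S = c%:S.
Proof.
apply: mpseriesP => m; rewrite mpsubstE (bigD1 bm0) //= eqxx big1 ?addr0.
  by rewrite mmap11 /=; case: ifP; rewrite ?mulr1 ?mulr0.
move=> j /eqP jn0; case: eqP => [j0|]; last by rewrite mul0r.
by case: jn0; apply: val_inj.
Qed.

Lemma mpsubst_var i : subst (mpvar i) = tnth g i.
Proof.
apply: mpseriesP => m.
(* At [m = 0] the sum stops below degree 1 and misses the monomial [U_(i)]; the value is still right
   because [tnth g i] has no constant term. *)
have [->|mn0] := eqVneq m 0%MM.
  rewrite g0 mpsubstE big1 //=  => j _; case: eqP => [->|]; last by rewrite mul0r.
  by rewrite mmap1U g0 mulr0.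
have U1 : (mdeg U_(i) < (mdeg m).+1)%N by rewrite mdeg1 ltnS lt0n mdeg_eq0.
rewrite mpsubstE (bigD1 (BMultinom U1)) //= eqxx mul1r mmap1U big1 ?addr0 //.
move=> j /eqP ne; case: eqP => [jE|]; last by rewrite mul0r.
by case: ne; apply: val_inj.
Qed.

Fact mpsubst_is_additive : zmod_morphism subst.
Proof.
move=> f h; apply: (addIr (subst h)).
by rewrite -mpsubstD !subrK.
Qed.

Fact mpsubst_is_multiplicative : monoid_morphism subst.
Proof. by split; [exact: (mpsubstC 1) | exact: mpsubstM]. Qed.

(** Packed as a term depending on [g0], the morphism laws being proved under that hypothesis. *)
Definition mpsubst_rmorphism : {rmorphism mpseries k R -> mpseries d R} :=
  HB.pack subst
    (GRing.isZmodMorphism.Build _ _ subst mpsubst_is_additive)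
    (GRing.isMonoidMorphism.Build _ _ subst mpsubst_is_multiplicative).

End Substitution.

Lemma ord3_ind (P : 'I_3 -> Prop) : P 0 -> P 1 -> P 2 -> forall i, P i.
Proof.
move=> P0 P1 P2 [[|[|[|//]]]] lt_i.
- by rewrite (_ : Ordinal _ = 0) //; apply: val_inj.
- by rewrite (_ : Ordinal _ = 1) //; apply: val_inj.
- by rewrite (_ : Ordinal _ = 2) //; apply: val_inj.
Qed.

Lemma mpvarX d (R : comNzRingType) (i : 'I_d) n :
  mpvar i ^+ n = mpmonomial (U_(i) *+ n)%MM :> mpseries d R.
Proof.
elim: n => [|n IH]; first by apply: mpseriesP => m; rewrite mulm0n /=; case: eqP.
by rewrite exprS IH mulmS mpmonomialD.
Qed.

Lemma mpcoef0M d (R : comNzRingType) (f g : mpseries d R) :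
  (f * g) 0%MM = f 0%MM * g 0%MM.
Proof.
rewrite mpcoefM (eq_bigl (pred1 (bm0, bm0))); first exact: big_pred1_eq.
case=> k1 k2 /=; rewrite eq_sym -mdeg_eq0 mdegD addn_eq0 !mdeg_eq0.
by rewrite xpair_eqE !bmeqP.
Qed.

Lemma mpvar0 d (R : comNzRingType) (i : 'I_d) : (mpvar i : mpseries d R) 0%MM = 0.
Proof. by rewrite /= eq_sym mnm1_eq0. Qed.

(** * Uniqueness of the expression in [u1 + u2], [u1 * u2] and [z] *)

Section SymmetricForm.
Variable R : comNzRingType.
Let u1 : mpseries 3 R := mpvar 0.
Let u2 : mpseries 3 R := mpvar 1.
Let z : mpseries 3 R := mpvar 2.
Let sp := [tuple u1 + u2; u1 * u2; z].

(** Modulo [u2], the power [(u1 + u2) ^+ n] is [u1 ^+ n]. *)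
Lemma mpcoef_exprD2 n (l : 'X_{1..3}) : l 1 = 0%N ->
  ((u1 + u2) ^+ n) l = (l == U_(0%R) *+ n)%MM%:R.
Proof.
elim: n l => [|n IH] l l1.
  by rewrite mulm0n /=; case: eqP.
rewrite exprSr mulrDr mpcoefD !mpcoefMX.
rewrite !lep1mP l1 eqxx addr0.
case: ifP => [l0|/negbFE/eqP l0]; last first.
  case: eqP => // lE; have := congr1 (fun q : 'X_{1..3} => q 0) lE.
  by rewrite l0 mulmnE mnm1E eqxx.
rewrite IH; last by rewrite mnmBE l1.
have Ul : (U_(0%R) <= l)%MM by rewrite lep1mP l0.
congr (nat_of_bool _)%:R; apply/eqP/eqP => [E|->].
  by rewrite mulmSr -E submK.
by rewrite mulmSr addmK.
Qed.

(** Triangularity: every monomial of s^j0 p^j1 z^j2 has [u2]-exponent at least j1, and the only one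
    attaining j1 is u1^(j0+j1) u2^j1 z^j2, with coefficient 1. *)
Lemma mpcoef_symmonomial (j m : 'X_{1..3}) : (m 1%R <= j 1%R)%N ->
  mmap1 (tnth sp) j (U_(0%R) *+ m 1%R + m)%MM = (j == m)%:R.
Proof.
move=> mj; rewrite /mmap1 !big_ord_recl big_ord0 mulr1.
(* The monomial of p^j1 z^j2; only the power of [u1 + u2] remains to be expanded. *)
pose K : 'X_{1..3} := (U_(0%R) *+ j 1%R + U_(1%R) *+ j 1%R + U_(2%R) *+ j 2%R)%MM.
have -> : tnth sp ord0 ^+ j ord0 * (tnth sp (lift ord0 ord0) ^+ j (lift ord0 ord0) *
    tnth sp (lift ord0 (lift ord0 ord0)) ^+ j (lift ord0 (lift ord0 ord0))) =
    (u1 + u2) ^+ j 0 * mpmonomial K.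
  rewrite !mpmonomialD -!mpvarX -exprMn.
  rewrite (_ : lift ord0 ord0 = 1); last exact: val_inj.
  by rewrite (_ : lift ord0 _ = 2); last exact: val_inj.
rewrite mpcoefMX.
have UE i k n : (U_(i) *+ n)%MM k = ((i == k :> 'I_3) * n)%N.
  by rewrite mulmnE mnm1E.
have M0 : (U_(0%R) *+ m 1%R + m)%MM 0 = (m 1%R + m 0%R)%N.
  by rewrite mnmDE UE mul1n.
have M1 : (U_(0%R) *+ m 1%R + m)%MM 1 = m 1 by rewrite mnmDE UE mul0n.
have M2 : (U_(0%R) *+ m 1%R + m)%MM 2 = m 2 by rewrite mnmDE UE mul0n.
have K0 : K 0 = j 1 by rewrite !mnmDE !UE !mul0n mul1n !addn0.
have K1 : K 1 = j 1 by rewrite !mnmDE !UE !mul0n mul1n !addn0.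
have K2 : K 2 = j 2 by rewrite !mnmDE !UE !mul0n mul1n.
case: ifP => [/mnm_lepP KM|KM].
  have jm : j 1 = m 1.
    by apply/eqP; rewrite eqn_leq mj andbT; have := KM 1; rewrite M1 K1.
  rewrite mpcoef_exprD2; last by rewrite mnmBE M1 K1 jm subnn.
  congr (nat_of_bool _)%:R; apply/eqP/eqP => [E|E].
    apply/mnmP; apply: ord3_ind => //.
      have := congr1 (fun q : 'X_{1..3} => q 0) E.
      by rewrite mnmBE M0 K0 jm UE mul1n addKn.
    have := congr1 (fun q : 'X_{1..3} => q 2) E; have := KM 2.
    rewrite mnmBE M2 K2 UE mul0n => ? /eqP.
    by rewrite subn_eq0 => ?; apply/eqP; rewrite eqn_leq; apply/andP.
  apply/mnmP; apply: ord3_ind; rewrite mnmBE UE.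
  - by rewrite M0 K0 jm addKn mul1n E.
  - by rewrite M1 K1 jm subnn mul0n.
  - by rewrite M2 K2 E subnn.
case: eqP => // jm; case/negP: KM; apply/mnm_lepP; rewrite -jm in M0 M1 M2 *.
by apply: ord3_ind; rewrite ?M0 ?M1 ?M2 ?K0 ?K1 ?K2 // leq_addr.
Qed.

(* The coefficient of [u1^(m0+m1) u2^m1 z^m2] involves only the coefficient of
   [m] and coefficients of smaller degree in the elementary symmetric [u1 u2]. *)
Lemma mpsubst_sym_inj : injective (mpsubst sp).
Proof.
move=> f h fh; apply: mpseriesP.
suff ind n : forall m : 'X_{1..3}, (m 1%R < n)%N -> f m = h m.
  by move=> m; apply: (ind (m 1%R).+1).
elim: n => // n IH m; rewrite ltnS leq_eqVlt => /orP[/eqP m1|]; last exact: IH.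
have := congr1 (fun q : mpseries 3 R => q (U_(0%R) *+ m 1%R + m)%MM) fh.
rewrite !mpsubstE.
have mM : (mdeg m < (mdeg (U_(0%R) *+ m 1%R + m)).+1)%N.
  by rewrite ltnS mdegD leq_addl.
rewrite (bigD1 (BMultinom mM)) //= [RHS](bigD1 (BMultinom mM)) //=.
rewrite mpcoef_symmonomial // eqxx !mulr1.
set A := bigop _ _ _; set B := bigop _ _ _; suff -> : A = B by apply: addIr.
apply: eq_bigr => j /eqP jm.
(* Terms with [j 1 < m 1] agree by induction; the others have coefficient 0 since [j] differs from
   [m]. *)
have [mj|jm1] := leqP (m 1) ((j : 'X_{1..3}) 1); last by rewrite IH -?m1.
rewrite mpcoef_symmonomial //; case: eqP => [E|]; last by rewrite !mulr0.
by case: jm; apply: val_inj.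
Qed.

End SymmetricForm.

(** * The explicit form Phi over an arbitrary commutative ring *)

Section Forms.
Variable A : comNzRingType.
Implicit Types e a u s p z : A.

(** The shape of [Funiv] with free ring elements as arguments, so that a morphism acts on it by
    acting on the arguments. *)
Definition quad_form e a u z : {poly A} :=
  1 + ((1 - e) * (u + z)) *: 'X
    + (- e * (u ^+ 2 + z ^+ 2) + a * (u * z)) *: 'X^2.

(* [phi1], ..., [phi4] are the coefficients of [t], ..., [t^4] in
   [F_t(u, z) F_t(v, z)], written in [s = u + v] and [p = u v]. *)
Definition phi1 e s z : A := (1 - e) * (s + 2 * z).

Definition phi2 e a s p z : A :=
  (1 - e) ^+ 2 * (p + s * z + z ^+ 2)
  - e * (s ^+ 2 - 2 * p + 2 * z ^+ 2) + a * s * z.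

Definition phi3 e a s p z : A :=
  (1 - e) * (- e * (p * s + s * z ^+ 2 + z * (s ^+ 2 - 2 * p) + 2 * z ^+ 3)
             + a * (2 * p * z + s * z ^+ 2)).

Definition phi4 e a s p z : A :=
  e ^+ 2 * (p ^+ 2 + z ^+ 2 * (s ^+ 2 - 2 * p) + z ^+ 4)
  - e * a * (p * s * z + s * z ^+ 3) + a ^+ 2 * p * z ^+ 2.

Definition phi_form e a s p z : {poly A} :=
  1 + phi1 e s z *: 'X + phi2 e a s p z *: 'X^2
    + phi3 e a s p z *: 'X^3 + phi4 e a s p z *: 'X^4.

Lemma phi_form_quad e a u v z :
  phi_form e a (u + v) (u * v) z = quad_form e a u z * quad_form e a v z.
Proof.
rewrite /phi_form /quad_form -!mul_polyC /phi1 /phi2 /phi3 /phi4.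
ring.
Qed.

Lemma phi_form_coefs e a s p z : let P := phi_form e a s p z in
  [/\ (size P <= 5)%N, P`_0 = 1, P`_1 = phi1 e s z, P`_2 = phi2 e a s p z
    & P`_3 = phi3 e a s p z /\ P`_4 = phi4 e a s p z].
Proof.
have PE i : (phi_form e a s p z)`_i = (i == 0%N)%:R + phi1 e s z * (i == 1%N)%:R
    + phi2 e a s p z * (i == 2)%:R + phi3 e a s p z * (i == 3)%:R
    + phi4 e a s p z * (i == 4)%:R.
  by rewrite /phi_form !(coefD, coefZ, coefX, coefXn, coef1).
split; last split; rewrite ?PE ?(mulr0, mulr1, addr0, add0r) //.
apply/leq_sizeP => i i5; rewrite PE.
by rewrite !gtn_eqF ?mulr0 ?addr0 //; apply: leq_trans i5.
Qed.

End Forms.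

Lemma map_quad_form (A B : comNzRingType) (f : {rmorphism A -> B}) e a u z :
  map_poly f (quad_form e a u z) = quad_form (f e) (f a) (f u) (f z).
Proof.
rewrite /quad_form 2!rmorphD /= !map_polyZ rmorph1 map_polyX map_polyXn /=.
by rewrite !(rmorphD, rmorphM, rmorphXn, rmorphN, rmorph1).
Qed.

Lemma map_phi_form (A B : comNzRingType) (f : {rmorphism A -> B}) e a s p z :
  map_poly f (phi_form e a s p z) = phi_form (f e) (f a) (f s) (f p) (f z).
Proof.
rewrite /phi_form 4!rmorphD /= !map_polyZ rmorph1 map_polyX !map_polyXn /=.
rewrite /phi1 /phi2 /phi3 /phi4.
by rewrite !(rmorphD, rmorphM, rmorphXn, rmorphN, rmorph1, rmorph_nat).
Qed.

(** * Computation of the iterate *)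

Lemma tuple2_const d (R : comNzRingType) (f g : mpseries d R) :
  f 0%MM = 0 -> g 0%MM = 0 -> forall i, tnth [tuple f; g] i 0%MM = 0.
Proof. by move=> f0 g0 [[|[|//]]]. Qed.

Lemma tuple3_const d (R : comNzRingType) (f g h : mpseries d R) :
  f 0%MM = 0 -> g 0%MM = 0 -> h 0%MM = 0 ->
  forall i, tnth [tuple f; g; h] i 0%MM = 0.
Proof. by move=> f0 g0 h0; apply: ord3_ind. Qed.

Section IterateFuniv.
Variables (R : comNzRingType) (eps a : R).

Lemma FunivE : Funiv eps a = quad_form eps%:S a%:S (mpvar 0) (mpvar 1).
Proof. by rewrite /Funiv /quad_form rmorphB rmorphN rmorph1. Qed.

Lemma tsubst_Funiv d (g : 2.-tuple (mpseries d R)) :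
  (forall i, tnth g i 0%MM = 0) ->
  tsubst g (Funiv eps a) = quad_form eps%:S a%:S (tnth g 0) (tnth g 1).
Proof.
move=> g0; rewrite FunivE -[tsubst _ _]/(map_poly (mpsubst_rmorphism g0) _).
by rewrite map_quad_form /= !mpsubstC // !mpsubst_var.
Qed.

Lemma tsubst_phi_form d (g : 3.-tuple (mpseries d R)) :
  (forall i, tnth g i 0%MM = 0) ->
  tsubst g (phi_form eps%:S a%:S (mpvar 0) (mpvar 1) (mpvar 2)) =
  phi_form eps%:S a%:S (tnth g 0) (tnth g 1) (tnth g 2).
Proof.
move=> g0; rewrite -[tsubst _ _]/(map_poly (mpsubst_rmorphism g0) _).
by rewrite map_phi_form /= !mpsubstC // !mpsubst_var.
Qed.

Lemma sym_form_Funiv : sym_form (Funiv eps a) =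
  phi_form eps%:S a%:S (mpvar 0) (mpvar 1) (mpvar 2).
Proof.
have sp0 : forall i, tnth [tuple mpvar 0 + mpvar 1; mpvar 0 * mpvar 1; mpvar 2
    : mpseries 3 R] i 0%MM = 0.
  by apply: tuple3_const; rewrite ?mpcoefD ?mpcoef0M !mpvar0 ?addr0 ?mul0r.
set P := phi_form _ _ _ _ _.
have symP : symmetrizes (Funiv eps a) P.
  rewrite /symmetrizes tsubst_phi_form //.
  rewrite !tsubst_Funiv; try exact: tuple2_const (mpvar0 _ _) (mpvar0 _ _).
  exact: phi_form_quad.
(* Since [P] is a witness, the choice made by [xget] satisfies the property instead of falling back
   on 0. *)
have : symmetrizes (Funiv eps a) (sym_form (Funiv eps a)).
  by rewrite /sym_form; apply: xgetPex; exists P.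
rewrite /symmetrizes /= -symP.
(* The chosen form and [P] have the same image under a substitution that is injective on each
   coefficient in [t]. *)
by apply: map_inj_poly; [exact: mpsubst_sym_inj | exact: mpsubst0].
Qed.

Lemma iterate_Funiv (x := mpvar 0 : mpseries 3 R) (y := mpvar 1 : mpseries 3 R)
    (z := mpvar 2 : mpseries 3 R) :
  iterate (Funiv eps a) =
  phi_form eps%:S a%:S ((1 - eps%:S) * (x + y))
    (- eps%:S * (x ^+ 2 + y ^+ 2) + a%:S * (x * y)) z.
Proof.
have xy0 := tuple2_const (mpvar0 R (0 : 'I_3)) (mpvar0 R (1 : 'I_3)).
have [_ F1 F2] := Funiv_coefs eps a.
have E1 : mpsubst [tuple x; y] (Funiv eps a)`_1 = (1 - eps%:S) * (x + y).
  rewrite F1 mpsubstM // mpsubstD !mpsubst_var // mpsubstC //.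
  by rewrite rmorphB rmorph1.
have E2 : mpsubst [tuple x; y] (Funiv eps a)`_2 =
    - eps%:S * (x ^+ 2 + y ^+ 2) + a%:S * (x * y).
  rewrite F2 -[mpsubst _ _]/(mpsubst_rmorphism xy0 _).
  rewrite !(rmorphD, rmorphM, rmorphXn) /= !mpsubst_var // !mpsubstC //.
  by rewrite rmorphN.
rewrite /iterate sym_form_Funiv E1 E2 tsubst_phi_form //.
by apply: tuple3_const; rewrite ?expr2 ?(mpcoefD, mpcoef0M) ?mpvar0 ?(mulr0, addr0).
Qed.

End IterateFuniv.

(** * Orbit sums in three variables *)

Lemma multinom3E (m : 'X_{1..3}) : m = mon3 (m 0) (m 1) (m 2).
Proof. by apply/mnmP; apply: ord3_ind. Qed.

(** Turns the orbit into an explicit list; [undup] stays, as coincidences depend on which exponents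
    are equal. *)
Lemma sigma_mon3 (R : comNzRingType) i j k : sigma (mon3 i j k) =
  \sum_(m <- undup [:: mon3 i j k; mon3 i k j; mon3 j i k; mon3 j k i;
                       mon3 k i j; mon3 k j i]) mpmonomial m :> mpseries 3 R.
Proof.
rewrite /sigma; apply: perm_big; apply: uniq_perm; rewrite ?undup_uniq // => m.
rewrite !mem_undup.
apply/mapP/idP => [[s _ ->]|].
  (* Distinctness of the three values leaves six of the 27 triples. *)
  have s01 : s 0 != s 1 by rewrite (inj_eq perm_inj).
  have s02 : s 0 != s 2 by rewrite (inj_eq perm_inj).
  have s12 : s 1 != s 2 by rewrite (inj_eq perm_inj).
  rewrite [X in X \in _]multinom3E !mnmE; move: (s 0) (s 1) (s 2) s01 s02 s12.
  by do 3!apply: ord3_ind => //; rewrite !inE eqxx ?orbT.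
(* One permutation per listed monomial, in order; the 3-cycles are products of transpositions, the
   left factor acting first. *)
rewrite !inE; case/or4P => [/eqP->|/eqP->|/eqP->|/or3P[]/eqP->];
  [ exists 1%g | exists (tperm 1 2) | exists (tperm 0 1)
  | exists (tperm 0%R 1%R * tperm 0%R 2%R)%g
  | exists (tperm 0%R 2%R * tperm 0%R 1%R)%g
  | exists (tperm 0 2) ] => //;
  rewrite ?mem_enum //; apply/mnmP; apply: ord3_ind;
  by rewrite mnmE ?permM !permE.
Qed.

Lemma mpmonomial_mon3 (R : comNzRingType) i j k : mpmonomial (mon3 i j k) =
  mpvar 0 ^+ i * mpvar 1 ^+ j * mpvar 2 ^+ k :> mpseries 3 R.
Proof.
rewrite !mpvarX -!mpmonomialD; congr mpmonomial.
apply/mnmP; apply: ord3_ind;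
  by rewrite !mnmDE !mulmnE !mnm1E /= !(mul0n, mul1n, addn0, add0n).
Qed.

(** * Reduction of the coefficients modulo the relations *)

Section Relations.
Variables (R : comNzRingType) (eps a : R).
Hypotheses (eps2 : eps ^+ 2 = 1) (eps_a : (1 + eps) * a = 0)
  (a_cubic : (a - (1 - eps)) ^+ 2 * (a + (1 - eps)) = 0).

(** With d = 1 - eps, one has d^2 = 2 d and d a = 2 a, so the cubic is a^3 - 2 a^2 - 4 a + 4 d. A
    monomial alone on the left is the form in which [ring] takes its hypotheses. *)
Lemma reduction_rules : [/\ eps ^+ 2 = 1, eps * a = - a
  & a ^+ 3 = 2 * a ^+ 2 + 4 * a - 4 + 4 * eps].
Proof.
have ea : eps * a = - a.
  by apply/eqP; rewrite -subr_eq0 opprK -{2}[a]mul1r -mulrDl addrC eps_a.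
split=> //; apply/eqP; rewrite -subr_eq0 -a_cubic; apply/eqP.
ring: eps2 ea.
Qed.

(** Stated for any ring with elements satisfying the relations, so that the quotient construction of
    [B0] stays out of the computation. *)
Lemma iterate_Funiv_coefs (C := iterate (Funiv eps a)) :
  [/\ is_nd_series 4 C,
      C`_1 = (2 * (1 - eps))%:S * sigma (mon3 1 0 0),
      C`_2 = (2 * (1 - 2 * eps))%:S * sigma (mon3 2 0 0)
             + ((a + 4) * (1 - eps))%:S * sigma (mon3 1 1 0),
      C`_3 = (2 * (1 - eps))%:S * sigma (mon3 3 0 0)
             + (2 * (1 - eps) * (1 + a))%:S * sigma (mon3 2 1 0)
             + (2 * (1 - eps) * (a ^+ 2 - a + 4))%:S * sigma (mon3 1 1 1)
    & C`_4 = sigma (mon3 4 0 0)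
             + (2 * a)%:S * sigma (mon3 3 1 0)
             + (2 + a ^+ 2)%:S * sigma (mon3 2 2 0)
             + (2 * (a ^+ 2 + a))%:S * sigma (mon3 2 1 1)].
Proof.
have [r1 r2 r3] := reduction_rules.
(* The rules are carried to constant series, because the identities to prove live in the power
   series ring. *)
have {r1} := congr1 (@mpseriesC 3 R) r1.
have {r2} := congr1 (@mpseriesC 3 R) r2.
have {r3} := congr1 (@mpseriesC 3 R) r3.
rewrite /C iterate_Funiv /is_nd_series !sigma_mon3 /=.
rewrite !big_cons !big_nil !mpmonomial_mon3.
rewrite !(rmorph_nat, rmorphXn, rmorph1, rmorphM, rmorphN, rmorphD) /=.
(* From here on the variables and constants are opaque ring elements, tied only by the three
   rules. *)
move: (mpvar 0) (mpvar 1) (mpvar 2) (eps%:S) (a%:S) => x y z e b r3 r2 r1.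
have [sz -> -> -> [-> ->]] := phi_form_coefs e b ((1 - e) * (x + y))
    (- e * (x ^+ 2 + y ^+ 2) + b * (x * y)) z.
split=> //; rewrite ?/phi1 ?/phi2 ?/phi3 ?/phi4.
- ring: r1 r2 r3.
- ring: r1 r2 r3.
- ring: r1 r2 r3.
- ring: r1 r2 r3.
Qed.
End Relations.

Theorem proposition4p0p3 :
  let eps := B0eps in
  let a := B0a in
  let C : {poly mpseries 3 B0} := iterate (Funiv eps a) in
  [/\ is_nd_series 4 C,
      C`_1 = (2 * (1 - eps))%:S * sigma (mon3 1 0 0),
      C`_2 = (2 * (1 - 2 * eps))%:S * sigma (mon3 2 0 0)
             + ((a + 4) * (1 - eps))%:S * sigma (mon3 1 1 0),
      C`_3 = (2 * (1 - eps))%:S * sigma (mon3 3 0 0)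
             + (2 * (1 - eps) * (1 + a))%:S * sigma (mon3 2 1 0)
             + (2 * (1 - eps) * (a ^+ 2 - a + 4))%:S * sigma (mon3 1 1 1)
    & C`_4 = sigma (mon3 4 0 0)
             + (2 * a)%:S * sigma (mon3 3 1 0)
             + (2 + a ^+ 2)%:S * sigma (mon3 2 2 0)
             + (2 * (a ^+ 2 + a))%:S * sigma (mon3 2 1 1)].
Proof.
by have [? ? ?] := B0rels; apply: iterate_Funiv_coefs.
Qed.
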